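(* Let $p$ be a prime. Then $$\sum_{k=0}^p (-1)^k \, \mathcal{B}_k \equiv \sum_{k=0}^p (-1)^k \, S(k) \equiv 0 \pmod{p},$$ and moreover $$\mathcal{B}_p \equiv 2 \pmod{p} \quad\text{and}\quad S(p) \equiv -1 \pmod{p}.$$
   Context: The subfactorial function is defined by $S(n)=n!\,\sum_{k=0}^{n}\frac{(-1)^k}{k!}$ for integers $n\ge 0$ (an integer, with $S(0)=1$, $S(1)=0$). $\mathcal{B}_n$ denotes the $n$-th Bell number, given by $\mathcal{B}_0=1$ and $\mathcal{B}_{n+1}=\sum_{k=0}^n \binom{n}{k}\mathcal{B}_k$ for $n\ge 0$. *)

(* Defs.v *)
From HB Require Import structures.
From mathcomp Require Import all_boot all_order all_algebra.

Set Implicit Arguments.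
Unset Strict Implicit.
Unset Printing Implicit Defensive.

Import Order.TTheory GRing.Theory Num.Theory.
Local Open Scope ring_scope.

Definition subfactorial_rat (n : nat) : rat :=
  n`!%:R * \sum_(0 <= k < n.+1) (-1) ^+ k / k`!%:R.

(* [numq] loses nothing: the value is an integer, see [subfactorialE]. *)
Definition subfactorial (n : nat) : int := numq (subfactorial_rat n).

Lemma subfactorial_rat0 : subfactorial_rat 0 = 1.
Proof. by rewrite /subfactorial_rat big_nat1 expr0 fact0 mulr1n divr1. Qed.

Lemma subfactorial_ratS (n : nat) :
  subfactorial_rat n.+1 = n.+1%:R * subfactorial_rat n + (-1) ^+ n.+1.
Proof.
rewrite /subfactorial_rat big_nat_recr //= mulrDr; congr (_ + _).
  by rewrite factS natrM mulrA.
by rewrite mulrC divfK // pnatr_eq0 -lt0n fact_gt0.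
Qed.

Lemma subfactorialE (n : nat) :
  (subfactorial n)%:~R = n`!%:R * \sum_(0 <= k < n.+1) (-1) ^+ k / k`!%:R :> rat.
Proof.
suff [z Ez] : exists z : int, subfactorial_rat n = z%:~R.
  by rewrite -[RHS]/(subfactorial_rat n) /subfactorial Ez numq_int.
elim: n => [|n [z Ez]]; first by exists 1; rewrite subfactorial_rat0.
exists (n.+1%:R * z + (-1) ^+ n.+1).
by rewrite subfactorial_ratS Ez rmorphD rmorphM rmorphXn rmorphN /= rmorph1 rmorph_nat.
Qed.

(* [bell_seq n] is [:: B_0; ...; B_n]. *)
Fixpoint bell_seq (n : nat) : seq nat :=
  if n is m.+1 then
    let s := bell_seq m in
    rcons s (\sum_(0 <= k < m.+1) 'C(m, k) * nth 0 s k)%N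
  else [:: 1%N].

Definition bell (n : nat) : nat := nth 0%N (bell_seq n) n.

Lemma size_bell_seq (n : nat) : size (bell_seq n) = n.+1.
Proof. by elim: n => //= n IHn; rewrite size_rcons IHn. Qed.

Lemma nth_bell_seq (n k : nat) : (k <= n)%N -> nth 0%N (bell_seq n) k = bell k.
Proof.
elim: n => [|n IHn]; first by rewrite leqn0 => /eqP->.
rewrite leq_eqVlt => /predU1P[-> // | lt_kn].
by rewrite /= nth_rcons size_bell_seq lt_kn IHn.
Qed.

Lemma bell0 : bell 0 = 1%N.
Proof. by []. Qed.

Lemma bellS (n : nat) :
  bell n.+1 = (\sum_(0 <= k < n.+1) 'C(n, k) * bell k)%N.
Proof.
rewrite {1}/bell /= nth_rcons size_bell_seq ltnn eqxx.
by rewrite !big_mkord; apply: eq_bigr => k _; rewrite nth_bell_seq // -ltnS.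
Qed.

(* Main.v *)
Require Import Defs.
From HB Require Import structures.
From mathcomp Require Import all_boot all_order all_algebra.
From mathcomp Require Import finfield.

Import Order.TTheory GRing.Theory Num.Theory.
Local Open Scope ring_scope.

(** Umbral calculus: let [L] be the linear form on polynomials with
    [L(X^n) = B_n].  The recurrence reads [L(X q(X)) = L(q(X + 1))], hence
    [L(X (X - 1) ... (X - n + 1)) = 1].  Over ['F_p] the falling factorial of
    length [p] is [X^p - X], so [B_p = 1 + B_1 = 2].  Since
    [C(p - 1, k) = (-1)^k] mod [p], the recurrence at [p] says
    [\sum_(k < p) (-1)^k B_k = B_p], which the last term [(-1)^p B_p = - B_p]
    cancels.  For subfactorials, [(-1)^n S(n) = \sum_i (-1)^i n^_i], and summing
    over [n < p] gives [\sum_i (-1)^i i! C(p, i + 1)], of which only the term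
    [i = p - 1] survives mod [p]; Wilson's theorem evaluates it to [-1]. *)

Section BellForm.
Variable R : comNzRingType.
Implicit Types q : {poly R}.

(** The codomain is [R^o], the ring as a module over itself, so that the form can be registered as a
    linear map. *)
Definition bell_form q : R^o := \sum_(i < size q) q`_i * (bell i)%:R.

Lemma bell_form_wide n q :
  (size q <= n)%N -> bell_form q = \sum_(i < n) q`_i * (bell i)%:R.
Proof.
move=> le_q_n; rewrite /bell_form.
rewrite (big_ord_widen _ (fun i => q`_i * (bell i)%:R) le_q_n) big_mkcond /=.
apply: eq_bigr => i _; case: ltnP => // le_q_i.
by rewrite nth_default // mul0r.
Qed.

Lemma bell_form_is_linear : linear bell_form.
Proof.
move=> a q r; pose n := maxn (size (a *: q + r)) (maxn (size q) (size r)).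
rewrite !(@bell_form_wide n) ?leq_max ?leqnn ?orbT //.
rewrite scaler_sumr -big_split /=; apply: eq_bigr => i _.
by rewrite coefD coefZ mulrDl -mulrA.
Qed.

HB.instance Definition _ :=
  GRing.isLinear.Build R {poly R} R^o _ bell_form bell_form_is_linear.

Lemma bell_formXn n : bell_form 'X^n = (bell n)%:R.
Proof.
rewrite (@bell_form_wide n.+1) ?size_polyXn // big_ord_recr /= big1 ?add0r.
  by rewrite coefXn eqxx mul1r.
by move=> i _; rewrite coefXn ltn_eqF // mul0r.
Qed.

Lemma bell_formXD1n n : bell_form (('X + 1) ^+ n) = (bell n.+1)%:R.
Proof.
rewrite addrC exprDn bellS big_mkord natr_sum (linear_sum bell_form).
apply: eq_bigr => k _.
by rewrite expr1n mul1r linearMn /= bell_formXn natrM mulr_natl.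
Qed.

(** By linearity it suffices to take [q = 'X^i], where [bell_formXD1n] gives the Bell recurrence. *)
Lemma bell_form_mulX q : bell_form ('X * q) = bell_form (q \Po ('X + 1)).
Proof.
rewrite -[q]coefK poly_def mulr_sumr (linear_sum (comp_poly _)) !(linear_sum bell_form).
apply: eq_bigr => i _; rewrite -scalerAr -exprS /= comp_polyZ comp_Xn_poly.
by rewrite !linearZ /= bell_formXn bell_formXD1n.
Qed.

(** The first factor is ['X]; trading it for the shift by 1 turns each remaining ['X - (i + 1)] into
    ['X - i], a product shorter by one. *)
Lemma bell_form_falling n : bell_form (\prod_(i < n) ('X - i%:R)) = 1.
Proof.
elim: n => [|n IHn]; first by rewrite big_ord0 -(expr0 'X) bell_formXn.
rewrite big_ord_recl subr0 bell_form_mulX rmorph_prod -[RHS]IHn.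
congr bell_form; apply: eq_bigr => i _.
rewrite lift0 rmorphB /= comp_polyX rmorph_nat -natr1.
by rewrite opprD addrACA addrN addr0.
Qed.

End BellForm.

Lemma subfactorialS n :
  subfactorial n.+1 = n.+1%:R * subfactorial n + (-1) ^+ n.+1.
Proof.
apply: (@intr_inj rat); rewrite rmorphD rmorphM rmorphXn rmorphN1 /=.
by rewrite rmorph_nat !subfactorialE -!/(subfactorial_rat _) subfactorial_ratS.
Qed.

(** Any bound [m > n] will do since [n ^_ i = 0] for [i > n]; this slack gives all [n < m] a common
    index range, so that sums can be exchanged. *)
Lemma sign_subfactorialE m n : (n < m)%N ->
  (-1) ^+ n * subfactorial n = \sum_(i < m) (-1) ^+ i * (n ^_ i)%:R.
Proof.
elim: n m => [|n IHn] [|m] // lt_n_m; rewrite big_ord_recl !ffactn0 !mul1r.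
  rewrite big1 ?addr0 => [|i _]; last by rewrite ffact0n mulr0.
  apply: (@intr_inj rat); rewrite subfactorialE -/(subfactorial_rat 0).
  by rewrite subfactorial_rat0.
(* The signs of the inhomogeneous term cancel, leaving 1, the term [i = 0]. *)
rewrite subfactorialS mulrDr -expr2 sqrr_sign addrC; congr (_ + _).
rewrite mulrCA exprS -mulrA (IHn m) // !mulr_sumr; apply: eq_bigr => i _.
by rewrite lift0 ffactSS natrM exprS !mulN1r mulNr mulrN mulrCA.
Qed.

Lemma sum_bin_col i n : (\sum_(k < n) 'C(k, i) = 'C(n, i.+1))%N.
Proof. by elim: n => [|n IHn]; rewrite ?big_ord0 // big_ord_recr IHn binS. Qed.

Lemma sum_sign_subfactorial n :
  \sum_(k < n) (-1) ^+ k * subfactorial k =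
  \sum_(i < n) (-1) ^+ i * ('C(n, i.+1) * i`!)%:R.
Proof.
under eq_bigr => k _ do rewrite (sign_subfactorialE _ _ (ltn_ord k)).
rewrite exchange_big; apply: eq_bigr => i _ /=.
rewrite -mulr_sumr -natr_sum -sum_bin_col big_distrl /=.
by congr (_ * _%:R); apply: eq_bigr => k _; rewrite bin_ffact.
Qed.

Section PrimeCharacteristic.
Variables (F : fieldType) (p : nat) (pcharFp : p \in [pchar F]).
Let p_pr : prime p := pcharf_prime pcharFp.
Let p_gt0 : (0 < p)%N := prime_gt0 p_pr.

Lemma eqz_mod_pchar (m n : int) :
  m%:~R = n%:~R :> F -> (m = n %[mod p%:Z])%Z.
Proof.
move=> eq_mn; apply/eqP; rewrite eqz_mod_dvd (dvdz_pcharf pcharFp).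
by rewrite rmorphB /= eq_mn subrr.
Qed.

Lemma pchar_signp : (-1) ^+ p = -1 :> F.
Proof. by rewrite -(pFrobenius_autE pcharFp) rmorphN1. Qed.

(** Pascal's rule: consecutive entries of row [p - 1] add up to an inner entry of row [p], which
    vanishes in [F]. *)
Lemma pchar_bin_pred k : (k < p)%N -> 'C(p.-1, k)%:R = (-1) ^+ k :> F.
Proof.
elim: k => [|k IHk] lt_k_p; first by rewrite bin0.
have /eqP : 'C(p, k.+1)%:R == 0 :> F.
  by rewrite -(dvdn_pcharf pcharFp) prime_dvd_bin // lt_k_p.
rewrite -{1}(prednK p_gt0) binS natrD IHk 1?ltnW // => /eqP.
by rewrite addr_eq0 => /eqP->; rewrite exprS mulN1r.
Qed.

Lemma pchar_sum_bell :
  \sum_(0 <= k < p.+1) (-1) ^+ k * (bell k)%:R = 0 :> F.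
Proof.
rewrite big_nat_recr //= pchar_signp mulN1r; apply/eqP; rewrite subr_eq0.
rewrite -[in bell p](prednK p_gt0) bellS (prednK p_gt0) natr_sum.
by apply/eqP/eq_big_nat => k /= lt_k_p; rewrite natrM pchar_bin_pred.
Qed.

Lemma pchar_subfactorial : (subfactorial p)%:~R = -1 :> F.
Proof.
rewrite -(prednK p_gt0) subfactorialS (prednK p_gt0).
rewrite rmorphD rmorphM rmorphXn rmorphN1 /= rmorph_nat.
by rewrite (pcharf0 pcharFp) mul0r add0r pchar_signp.
Qed.

Lemma pchar_sum_subfactorial :
  (\sum_(0 <= k < p.+1) (-1) ^+ k * subfactorial k)%:~R = 0 :> F.
Proof.
have fact_pred : p.-1`!%:R = -1 :> F.
  apply/eqP; rewrite -addr_eq0 natr1 -(dvdn_pcharf pcharFp).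
  by rewrite -Wilson ?prime_gt1.
(* Taking [k = p - 1] in [pchar_bin_pred] avoids a case split on the parity of [p]. *)
have sign_pred : (-1) ^+ p.-1 = 1 :> F.
  by rewrite -pchar_bin_pred ?ltn_predL // binn.
(* The term [k = p] is [(-1) * (-1) = 1]; it has to cancel the sum over [k < p]. *)
rewrite big_nat_recr //= big_mkord sum_sign_subfactorial.
rewrite rmorphD rmorphM /= pchar_subfactorial rmorphXn rmorphN1 pchar_signp.
rewrite rmorph_sum -(big_mkord xpredT (fun i =>
  ((-1) ^+ i * ('C(p, i.+1) * i`!)%:R)%:~R)) -{1}(prednK p_gt0).
rewrite big_nat_recr //= big_nat big1 => [|i /= lt_i_p].
  rewrite rmorphM rmorph_nat rmorphXn rmorphN1 /= (prednK p_gt0) binn mul1n.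
  by rewrite sign_pred fact_pred add0r mul1r mulrNN mulr1 addNr.
rewrite rmorphM /= rmorph_nat natrM; apply/eqP.
rewrite !mulf_eq0 -(dvdn_pcharf pcharFp 'C(_, _)).
by rewrite prime_dvd_bin ?orbT //= -ltn_predRL.
Qed.

End PrimeCharacteristic.

(** Both sides are the product of ['X - a] over all [a] in ['F_p]. *)
Lemma Fp_falling (p : nat) :
  prime p -> \prod_(i < p) ('X - i%:R) = 'X^p - 'X :> {poly 'F_p}.
Proof.
move=> p_pr; have := finField_genPoly 'F_p; rewrite card_Fp // => ->.
(* The ordinal bound underlying ['F_p] is only provably equal to [p]; the index range must change
   while the field stays fixed. *)
have prod_cast m : m = p ->
  \prod_(i < p) ('X - i%:R) = \prod_(i < m) ('X - i%:R) :> {poly 'F_p} by move=> ->.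
rewrite (prod_cast _ (Fp_cast p_pr)).
by apply: eq_bigr => i _; rewrite -{2}[i]natr_Zp polyC_natr.
Qed.

Lemma Fp_bell (p : nat) : prime p -> (bell p)%:R = 2 :> 'F_p.
Proof.
move=> p_pr; have := bell_form_falling 'F_p p.
rewrite Fp_falling // linearB /= -{2}['X]expr1 !bell_formXn bellS big_nat1.
by move/eqP; rewrite subr_eq => /eqP.
Qed.

Theorem lemma1p2 (p : nat) (hp : prime p) :
  [/\ (\sum_(0 <= k < p.+1) (-1) ^+ k * (bell k)%:Z =
       \sum_(0 <= k < p.+1) (-1) ^+ k * subfactorial k %[mod p%:Z])%Z,
      (\sum_(0 <= k < p.+1) (-1) ^+ k * subfactorial k = 0 %[mod p%:Z])%Z,
      ((bell p)%:Z = 2 %[mod p%:Z])%Z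
    & (subfactorial p = -1 %[mod p%:Z])%Z].
Proof.
have pchar_p := pchar_Fp hp; split; apply: (eqz_mod_pchar _ _ pchar_p).
- rewrite (pchar_sum_subfactorial _ _ pchar_p) -[RHS](pchar_sum_bell _ _ pchar_p).
  rewrite rmorph_sum; apply: eq_bigr => k _.
  by rewrite rmorphM rmorphXn rmorphN1.
- exact: pchar_sum_subfactorial.
- exact: Fp_bell.
- by rewrite (pchar_subfactorial _ _ pchar_p) rmorphN1.
Qed.
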